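(* Let $f,g\in\mathbb{R}_n[x]$ be strictly $b$-mesh polynomials of degree $n$. Let $T_g:\mathbb{R}_n[x]\to\mathbb{R}_n[x]$ be the real linear operator defined by $T_g:r\mapsto r\boxplus_b^n g$. Then $T_g$ preserves interlacing with respect to $f$; that is, for all $r\in\mathbb{R}_n[x]$, $r\ll f$ implies $T_g[r]\ll T_g[f]$, and $f\ll r$ implies $T_g[f]\ll T_g[r]$.
   Context: Here $b>0$, and $\mathbb{R}_n[x]$ is the space of real polynomials of degree at most $n$. A polynomial with all real roots is strictly $b$-mesh if the minimum non-negative difference of any pair of its roots (counted with multiplicity) is greater than $b$. For $u,w\in\mathbb{R}[x]$, $u\ll w$ means $u'w-uw'\le0$ on $\mathbb{R}$ (equivalently $(u/w)'\le0$ wherever defined). With $(\Delta_bp)(x):=\frac{p(x)-p(x-b)}{b}$, the $b$-additive convolution is $p\boxplus_b^n r:=\sum_{k=0}^n\Delta_b^kp\cdot(\Delta_b^{n-k}r)(0)$ for $p,r$ of degree at most $n$. *)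

(* Defs.v *)
From HB Require Import structures.
From mathcomp Require Import all_boot all_order all_algebra.
From mathcomp Require Import reals.

Set Implicit Arguments.
Unset Strict Implicit.
Unset Printing Implicit Defensive.

Import Order.TTheory GRing.Theory Num.Theory.
Local Open Scope ring_scope.

(* [s] lists the roots with multiplicity, so a multiple root contributes a
   pair at distance 0; with at most one root the pairwise condition is void. *)
Definition strictly_mesh (R : realType) (b : R) (p : {poly R}) : Prop :=
  p != 0 /\
  exists2 s : seq R,
    p = lead_coef p *: \prod_(x <- s) ('X - x%:P) &
    pairwise (fun x y => b < `|x - y|) s.

Definition interlace (R : realType) (u w : {poly R}) : Prop :=
  forall x : R, (u^`() * w - u * w^`()).[x] <= 0.

Notation "u '<<|' w" := (interlace u w) (at level 70, no associativity).

Definition fdiff (R : realType) (b : R) (p : {poly R}) : {poly R} :=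
  b^-1 *: (p - (p \Po ('X - b%:P))).

Definition additive_conv (R : realType) (b : R) (n : nat) (p r : {poly R}) :
    {poly R} :=
  \sum_(k < n.+1) (iter (n - k) (fdiff b) r).[0] *: iter k (fdiff b) p.

(* Total on {poly R}; [conv_op_linear] and [size_conv_op] show that it
   restricts to a linear endomorphism of the polynomials of degree <= n. *)
Definition conv_op (R : realType) (b : R) (n : nat) (g : {poly R}) :
    {poly R} -> {poly R} :=
  fun r => additive_conv b n r g.

Lemma fdiffE (R : realType) (b : R) (p : {poly R}) (x : R) :
  (fdiff b p).[x] = (p.[x] - p.[x - b]) / b.
Proof.
by rewrite /fdiff hornerZ hornerD hornerN horner_comp !hornerE mulrC.
Qed.

Lemma fdiff_linear (R : realType) (b : R) : linear (@fdiff R b).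
Proof.
move=> a p q; rewrite /fdiff linearP /= opprD addrACA -scalerBr scalerDr.
by rewrite !scalerA mulrC.
Qed.

HB.instance Definition _ (R : realType) (b : R) :=
  GRing.isLinear.Build R {poly R} {poly R} *:%R (@fdiff R b) (fdiff_linear b).

Lemma conv_op_linear (R : realType) (b : R) (n : nat) (g : {poly R}) :
  linear (conv_op b n g).
Proof.
move=> a p q; rewrite /conv_op /additive_conv scaler_sumr -big_split /=.
apply: eq_bigr => k _.
have -> : iter k (fdiff b) (a *: p + q)
          = a *: iter k (fdiff b) p + iter k (fdiff b) q.
  by elim: (nat_of_ord k) => [|m IHm] //=; rewrite IHm linearP.
by rewrite scalerDr !scalerA mulrC.
Qed.

HB.instance Definition _ (R : realType) (b : R) (n : nat) (g : {poly R}) :=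
  GRing.isLinear.Build R {poly R} {poly R} *:%R (conv_op b n g)
    (conv_op_linear b n g).

Lemma size_fdiff (R : realType) (b : R) (p : {poly R}) :
  (size (fdiff b p) <= size p)%N.
Proof.
apply: leq_trans (size_scale_leq _ _) _.
apply: leq_trans (size_polyD _ _) _.
by rewrite size_polyN geq_max leqnn /= size_comp_poly2 // size_XsubC.
Qed.

Lemma size_conv_op (R : realType) (b : R) (n : nat) (g r : {poly R}) :
  (size r <= n.+1)%N -> (size (conv_op b n g r) <= n.+1)%N.
Proof.
move=> hr; apply: leq_trans (size_sum _ _ _) _.
apply/bigmax_leqP => k _; apply: leq_trans (size_scale_leq _ _) _.
elim: (nat_of_ord k) => [|m IHm] //=.
exact: leq_trans (size_fdiff _ _) IHm.
Qed.

(* Main.v *)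
From HB Require Import structures.
Require Import Defs.
From mathcomp Require Import all_boot all_order all_algebra.
From mathcomp Require Import reals.
From mathcomp Require Import ring lra.

(** Write D for the backward difference of step b, W(u, w) = u' w - u w' for
    the Wronskian, so that u << w means W(u, w) <= 0 everywhere, and p * g for
    the degree-n convolution.

    Reduction to one root.  Interlacing with a fixed f is a linear condition
    on r.  If f = c prod_(x in s) (X - x), Lagrange interpolation at s writes
    r = a f + sum_(m in s) r_m f_m, where f_m is the product without the factor
    X - m, and r << f evaluated at m says exactly that c r_m >= 0
    ([interlace_nodes]).  The multiple of f contributes nothing to W(r, f), nor
    to its image, so it suffices to treat r = f_m ([conv_interlace]).  The
    second implication is the first one applied to -r.

    The induction.  Let p = f_m, of degree n, and let g have degree n + 1 and
    root list t.  The product rule for D gives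
      (X p) *_(n+1) g = X P + p *_n h,  P = p *_(n+1) g = p *_n (D g),
    where h = (n+1) g(x - b) - (x - b) (D g)(x) has degree at most n
    ([additive_conv_mulX], [size_polar]).  Both D g and h are then combinations
    of the polynomials g_m = g / (X - m), m in t, with related coefficients:
      D g = sum_m a_m g_m,   h = - sum_m a_m (m + n b) g_m,
    where a_m is the product over the other roots y of 1 - b / (m - y).  This
    is where the mesh condition enters: every a_m is nonnegative
    ([mesh_weight_ge0]).  With A_m = p *_n g_m, expanding and symmetrizing gives
      W(P, (X p) *_(n+1) g)
        = - P^2 - 1/2 sum_(m, v) a_m a_v (v - m) W(A_m, A_v).
    Moreover g_v - g_m is (v - m) times the product g_mv with both factors
    removed, hence (v - m) W(A_m, A_v) = (v - m)^2 W(A_m, p *_n g_mv).  Since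
    the convolution is symmetric ([additive_convC]), W(p *_n g_mv, A_m) <= 0 is
    the same statement one degree lower, with the factor removed from g instead
    of from f ([conv_interlace_mulX]). *)

Import Order.TTheory GRing.Theory Num.Theory.
Local Open Scope ring_scope.

(** * The backward difference and the additive convolution *)

Section Fdiff.
Context {R : realType} (b : R).
Implicit Types p q r : {poly R}.

Local Notation D := (fdiff b).

(** The shifted value p(x - b) of the product rule is absorbed in the
    coefficient X - b, so that only powers of D occur under iteration. *)
Lemma fdiff_mulX p : b != 0 -> D ('X * p) = ('X - b%:P) * D p + p.
Proof.
move=> b0; rewrite /fdiff comp_polyM comp_polyX.
have bb : b^-1%:P * b%:P = 1 :> {poly R} by rewrite -polyCM mulVf.
rewrite -!mul_polyC -[X in _ = _ + X]mul1r -bb.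
by move: (b^-1)%:P (b%:P) (_ \Po _) => u v w; ring.
Qed.

Lemma fdiffC c : D c%:P = 0.
Proof. by rewrite /fdiff comp_polyC subrr scaler0. Qed.

Lemma fdiffZ c p : D (c *: p) = c *: D p.
Proof. exact: linearZ. Qed.

(** The product rule propagates the drop of degree along Horner's scheme. *)
Lemma size_fdiff_pred p : b != 0 -> (size (D p) <= (size p).-1)%N.
Proof.
move=> b0; elim/poly_ind: p => [|p c IHp]; first by rewrite raddf0 size_poly0.
rewrite raddfD /= fdiffC addr0 mulrC fdiff_mulX //.
have [->|p0] := eqVneq p 0; first by rewrite raddf0 mulr0 addr0 size_poly0.
rewrite mulrC size_MXaddC (negbTE p0) /=.
have sp : (0 < size p)%N by rewrite size_poly_gt0.
rewrite (leq_trans (size_polyD _ _)) // geq_max leqnn andbT.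
rewrite (leq_trans (size_polyMleq _ _)) // size_XsubC /=.
by rewrite (leq_ltn_trans IHp) // prednK.
Qed.

Lemma size_iter_fdiff k p :
  b != 0 -> (size (iter k D p) <= size p - k)%N.
Proof.
move=> b0; elim: k => [|k IHk]; first by rewrite subn0.
rewrite iterS (leq_trans (size_fdiff_pred _ b0)) // subnS -!subn1.
exact: leq_sub2r.
Qed.

Lemma iter_fdiff_eq0 k p : b != 0 -> (size p <= k)%N -> iter k D p = 0.
Proof.
move=> b0 pk; apply/eqP; rewrite -size_poly_eq0 -leqn0.
by apply: leq_trans (size_iter_fdiff k p b0) _; rewrite leqn0 subn_eq0.
Qed.

Lemma iter_fdiff_linear k : linear (iter k D).
Proof. by elim: k => [|k IHk] a p q //=; rewrite IHk linearP. Qed.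

HB.instance Definition _ k :=
  GRing.isLinear.Build R {poly R} {poly R} *:%R (iter k D)
    (iter_fdiff_linear k).

Lemma iter_fdiff_mulX k p : b != 0 ->
  iter k D ('X * p) = ('X - (k%:R * b)%:P) * iter k D p + iter k.-1 D p *+ k.
Proof.
move=> b0; elim: k => [|k IHk]; first by rewrite /= mul0r subr0 addr0.
rewrite iterS IHk mulrBl mul_polyC.
rewrite [LHS](raddfD D) (raddfB D) (raddfMn D) /= fdiffZ fdiff_mulX //.
have -> : D (iter k.-1 D p) *+ k = iter k D p *+ k by case: (k).
have -> : k.+1%:R * b = k%:R * b + b by rewrite -natr1 mulrDl mul1r.
rewrite -mul_polyC polyCD mulrS; ring.
Qed.

(** Expanding either shift produces b times the sum of the D^i r(y) D^j p(x)
    over i + j = n + 1; the extreme terms, which differ between the two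
    expansions, vanish for degree reasons. *)
Lemma conv_summation_by_parts n p r x y : b != 0 ->
    (size p <= n.+1)%N -> (size r <= n.+1)%N ->
  let F x y := \sum_(k < n.+1) (iter (n - k) D r).[y] * (iter k D p).[x] in
  F (x - b) y = F x (y - b).
Proof.
move=> b0 sp sr /=.
have stepE k q z : (iter k D q).[z - b] =
    (iter k D q).[z] - b * (iter k.+1 D q).[z].
  by rewrite iterS fdiffE mulrC divfK // subKr.
under eq_bigr => k _ do rewrite stepE mulrBr.
under [RHS]eq_bigr => k _ do rewrite stepE mulrBl.
rewrite !sumrB; congr (_ - _).
rewrite big_ord_recr /= -iterS (iter_fdiff_eq0 _ _ b0 sp) horner0 !mulr0 addr0.
rewrite big_ord_recl /= subn0 -iterS (iter_fdiff_eq0 _ _ b0 sr) horner0 mulr0.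
rewrite mul0r add0r; apply: eq_bigr => k _.
have -> : (n - k = (n - bump 0 k).+1)%N by rewrite /bump add1n subnSK.
rewrite /bump add1n !iterS; ring.
Qed.

Lemma poly_eq_on_progression p q : b != 0 ->
  (forall k, p.[k%:R * b] = q.[k%:R * b]) -> p = q.
Proof.
move=> b0 pq; apply/eqP; rewrite -subr_eq0; apply/eqP.
pose rs : seq R := [seq k%:R * b | k <- iota 0 (size (p - q))].
apply: (@roots_geq_poly_eq0 _ _ rs).
- by apply/allP => _ /mapP[k _ ->]; rewrite rootE !hornerE pq subrr.
- rewrite map_inj_uniq ?iota_uniq // => i j /(mulIf b0) /eqP.
  by rewrite eqr_nat => /eqP.
- by rewrite size_map size_iota.
Qed.

(** The two sides are F(x, 0) and F(0, x) for the kernel F of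
    [conv_summation_by_parts].  Shifting by b along the antidiagonal identifies
    them at all multiples of b, which is enough for polynomials. *)
Lemma additive_convC n p r : b != 0 ->
    (size p <= n.+1)%N -> (size r <= n.+1)%N ->
  additive_conv b n p r = additive_conv b n r p.
Proof.
move=> b0 sp sr; apply: (poly_eq_on_progression _ _ b0) => m.
pose F x y := \sum_(k < n.+1) (iter (n - k) D r).[y] * (iter k D p).[x].
have shiftF k y : F (k%:R * b) y = F 0 (y + k%:R * b).
  elim: k y => [|k IHk] y; first by rewrite mul0r addr0.
  have := conv_summation_by_parts _ _ _ (k.+1%:R * b) (y + b) b0 sp sr.
  rewrite /= -/(F _ _) -/(F _ _) addrK => <-.
  rewrite -natr1 mulrDl mul1r addrK IHk; congr (F 0 _); ring.
transitivity (F (m%:R * b) 0).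
  by rewrite /additive_conv horner_sum; apply: eq_bigr => k _; rewrite hornerZ.
rewrite shiftF add0r /additive_conv horner_sum /F.
rewrite (reindex_inj rev_ord_inj) /=; apply: eq_bigr => k _.
have kn : (k <= n)%N by rewrite -ltnS.
by rewrite hornerZ subSS (subKn kn) mulrC.
Qed.

Lemma additive_conv_linear_r n p : linear (additive_conv b n p).
Proof.
move=> a q r; rewrite /additive_conv scaler_sumr -big_split /=.
apply: eq_bigr => k _.
by rewrite linearP /= hornerD hornerZ scalerDl scalerA.
Qed.

HB.instance Definition _ n p :=
  GRing.isLinear.Build R {poly R} {poly R} *:%R (additive_conv b n p)
    (additive_conv_linear_r n p).

Lemma additive_conv_lower n p g : b != 0 -> (size p <= n.+1)%N ->
  additive_conv b n.+1 p g = additive_conv b n p (D g).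
Proof.
move=> b0 sp; rewrite /additive_conv big_ord_recr /= subnn -iterS.
rewrite (iter_fdiff_eq0 _ _ b0 sp) scaler0 addr0; apply: eq_bigr => k _.
by rewrite -iterSr subSn // -ltnS.
Qed.

(** This is n g(x - b) - (x - b) (D g)(x), a finite difference version of the
    polar derivative n g - x g'. *)
Definition polar n g := n%:R *: (g - b *: D g) - ('X - b%:P) * D g.

(** Convolution with g is a polynomial in D whose coefficients are the
    differences of g at 0; multiplying the argument by X brings in the formal
    derivative of that polynomial, and [polar] has the matching differences
    at 0. *)
Lemma additive_conv_mulX n p g : b != 0 -> (size p <= n.+1)%N ->
  additive_conv b n.+1 ('X * p) g =
  'X * additive_conv b n.+1 p g + additive_conv b n p (polar n.+1 g).
Proof.
move=> b0 sp.
pose c k := (iter (n.+1 - k) D g).[0].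
have polarE (k : nat) : (k <= n)%N -> (iter (n - k) D (polar n.+1 g)).[0] =
    k.+1%:R * c k.+1 - k%:R * b * c k.
  move=> kn; rewrite /c /polar mulrBl mul_polyC subSS.
  have TB q r : iter (n - k) D (q - r) = iter (n - k) D q - iter (n - k) D r.
    exact: raddfB.
  have TZ a q : iter (n - k) D (a *: q) = a *: iter (n - k) D q.
    exact: linearZ.
  rewrite TB TZ TB TB !(TZ b) iter_fdiff_mulX // -iterSr.
  have -> : iter (n - k).-1 D (D g) *+ (n - k) = iter (n - k) D g *+ (n - k).
    by case: (n - k)%N => // i; rewrite iterSr.
  rewrite -subSn // !(hornerD, hornerN, hornerZ, hornerM, hornerX, hornerC).
  have -> : n.+1%:R = (n - k)%:R + k.+1%:R :> R by rewrite -natrD addnS subnK.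
  rewrite hornerMn -mulr_natl -[k.+1%:R]natr1; ring.
rewrite /additive_conv mulr_sumr.
have -> : \sum_(k < n.+1) (iter (n - k) D (polar n.+1 g)).[0] *: iter k D p =
  \sum_(k < n.+2) c k *: (iter k.-1 D p *+ k - (k%:R * b) *: iter k D p).
  under [RHS]eq_bigr => k _ do rewrite scalerBr.
  rewrite sumrB [X in _ = X - _]big_ord_recl [X in _ = _ - X]big_ord_recr /=.
  rewrite mulr0n scaler0 add0r -iterS (iter_fdiff_eq0 _ _ b0 sp) !scaler0.
  rewrite addr0 -sumrB; apply: eq_bigr => k _.
  have kn : (k <= n)%N by rewrite -ltnS.
  rewrite /bump /= add1n add0n (polarE _ kn).
  rewrite -scaler_nat !scalerA -scalerBl.
  by congr (_ *: _); ring.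
rewrite -big_split /=; apply: eq_bigr => k _.
rewrite iter_fdiff_mulX // /c -!mul_polyC; ring.
Qed.

End Fdiff.

(** * Wronskians and products of linear factors *)

Section Wronskian.
Context {R : realType}.
Implicit Types (p q u w : {poly R}) (s : seq R).

Definition wronskian u w : {poly R} := u^`() * w - u * w^`().

Lemma wronskianC u w : wronskian u w = - wronskian w u.
Proof. by rewrite /wronskian; ring. Qed.

Lemma wronskianxx u : wronskian u u = 0.
Proof. by rewrite /wronskian; ring. Qed.

Lemma wronskianDr u w v : wronskian u (w + v) = wronskian u w + wronskian u v.
Proof. by rewrite /wronskian derivD; ring. Qed.

Lemma wronskianZr a u w : wronskian u (a *: w) = a *: wronskian u w.
Proof. by rewrite /wronskian derivZ -!mul_polyC; ring. Qed.

Lemma wronskianZl a u w : wronskian (a *: u) w = a *: wronskian u w.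
Proof. by rewrite wronskianC wronskianZr -scalerN -wronskianC. Qed.

Lemma wronskianNl u w : wronskian (- u) w = - wronskian u w.
Proof. by rewrite -scaleN1r wronskianZl scaleN1r. Qed.

Lemma wronskian_sumr (I : Type) (l : seq I) u (F : I -> {poly R}) :
  wronskian u (\sum_(i <- l) F i) = \sum_(i <- l) wronskian u (F i).
Proof.
elim/big_rec2: _ => [|i w v _ <-]; last by rewrite wronskianDr.
by rewrite /wronskian deriv0; ring.
Qed.

Lemma wronskian_suml (I : Type) (l : seq I) w (F : I -> {poly R}) :
  wronskian (\sum_(i <- l) F i) w = \sum_(i <- l) wronskian (F i) w.
Proof.
rewrite wronskianC wronskian_sumr -sumrN.
by apply: eq_bigr => i _; rewrite -wronskianC.
Qed.

(** Antisymmetry of the Wronskian turns the double sum of the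
    a_m a_v c_v W(A_m, A_v) into half that of the
    a_m a_v (c_v - c_m) W(A_m, A_v), which is termwise nonnegative. *)
Lemma wronskian_weighted_chain (s : seq R) (a c : R -> R) (A : R -> {poly R})
    (x : R) :
    (forall m, m \in s -> 0 <= a m) ->
    {in s &, forall m v, 0 <= (c v - c m) * (wronskian (A m) (A v)).[x]} ->
  0 <= (wronskian (\sum_(m <- s) a m *: A m)
                  (\sum_(m <- s) (a m * c m) *: A m)).[x].
Proof.
move=> a0 Ac; set S := (wronskian _ _).[x].
have SE : S = \sum_(m <- s) \sum_(v <- s)
    a m * a v * c v * (wronskian (A m) (A v)).[x].
  rewrite /S wronskian_suml horner_sum; apply: eq_bigr => m _.
  rewrite wronskian_sumr horner_sum; apply: eq_bigr => v _.
  by rewrite wronskianZl wronskianZr !hornerZ; ring.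
have SE' : S = - \sum_(m <- s) \sum_(v <- s)
    a m * a v * c m * (wronskian (A m) (A v)).[x].
  rewrite SE exchange_big -sumrN; apply: eq_bigr => m _.
  rewrite -sumrN; apply: eq_bigr => v _.
  by rewrite wronskianC hornerN; ring.
suff: 0 <= S + S by lra.
rewrite {1}SE {1}SE' -sumrB big_seq; apply: sumr_ge0 => m ms.
rewrite -sumrB big_seq; apply: sumr_ge0 => v vs.
have := mulr_ge0 (mulr_ge0 (a0 m ms) (a0 v vs)) (Ac m v ms vs).
by congr (_ <= _); ring.
Qed.

Definition root_poly s : {poly R} := \prod_(x <- s) ('X - x%:P).

Lemma size_root_poly s : size (root_poly s) = (size s).+1.
Proof. exact: size_prod_XsubC. Qed.

Lemma root_poly_rem s m :
  m \in s -> root_poly s = ('X - m%:P) * root_poly (rem m s).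
Proof.
by move=> ms; rewrite /root_poly (perm_big _ (perm_to_rem ms)) big_cons.
Qed.

Lemma root_poly_rem2 s m v : m \in rem v s -> v \in s -> m \in s ->
  root_poly (rem m s) = ('X - v%:P) * root_poly (rem m (rem v s)).
Proof.
move=> mvs vs ms; apply: (@mulfI _ ('X - m%:P)); first by rewrite polyXsubC_eq0.
rewrite -root_poly_rem // mulrCA -root_poly_rem //; exact: root_poly_rem.
Qed.

Lemma horner_root_poly s x : (root_poly s).[x] = \prod_(y <- s) (x - y).
Proof.
by rewrite horner_prod; apply: eq_bigr => y _; rewrite hornerXsubC.
Qed.

Lemma root_poly_rem_neq0 s m : uniq s -> (root_poly (rem m s)).[m] != 0.
Proof.
move=> us; rewrite horner_root_poly prodf_seq_neq0; apply/allP => y /=.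
by rewrite mem_rem_uniq // !inE subr_eq0 eq_sym => /andP[].
Qed.

Lemma lagrange_interpolation s p : uniq s -> (size p <= size s)%N ->
  p = \sum_(m <- s)
        (p.[m] / (root_poly (rem m s)).[m]) *: root_poly (rem m s).
Proof.
move=> us ps; apply/eqP; rewrite -subr_eq0; apply/eqP.
apply: (@roots_geq_poly_eq0 _ _ s) => //.
  apply/allP => v vs; rewrite rootE hornerD hornerN horner_sum.
  rewrite (bigD1_seq v) //= hornerZ divfK ?root_poly_rem_neq0 //.
  rewrite big_seq_cond big1 ?addr0 ?subrr // => m /andP[ms mv].
  have vm : v \in rem m s by rewrite mem_rem_uniq // inE eq_sym mv.
  rewrite hornerZ [X in _ * X.[v]](root_poly_rem _ _ vm).
  by rewrite [X in _ * X]hornerM hornerXsubC subrr mul0r mulr0.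
apply: leq_trans (size_polyD _ _) _; rewrite geq_max ps size_polyN /=.
apply: leq_trans (size_sum _ _ _) _; apply/bigmax_leqP_seq => m ms _.
apply: leq_trans (size_scale_leq _ _) _.
by rewrite size_root_poly size_rem // prednK // -has_predT; apply/hasP; exists m.
Qed.

End Wronskian.

(** * Difference expansions over the roots of a mesh polynomial *)

Section Mesh.
Context {R : realType} (b : R) (b_gt0 : 0 < b).
Implicit Types (p g : {poly R}) (s t : seq R).

Let b0 : b != 0. Proof. by rewrite gt_eqF. Qed.

Definition mesh s := pairwise (fun x y => b < `|x - y|) s.

Lemma mesh_uniq s : mesh s -> uniq s.
Proof.
rewrite uniq_pairwise; apply: sub_pairwise => x y /=.
by apply: contraTneq => ->; rewrite subrr normr0 -leNgt ltW.
Qed.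

Lemma mesh_rem s m : mesh s -> mesh (rem m s).
Proof. exact: subseq_pairwise (rem_subseq _ _). Qed.

Lemma mesh_gap s : mesh s -> {in s &, forall m v, m != v -> b < `|m - v|}.
Proof.
elim: s => [|y s IHs] //= /andP[/allP ys ss] m v.
rewrite !inE => /predU1P[->|ms] /predU1P[->|vs]; rewrite ?eqxx // => mv.
- exact: ys.
- by rewrite distrC; apply: ys.
- exact: IHs.
Qed.

(** The terms of top degree of n g and X (D g) cancel; the induction makes this
    visible without computing leading coefficients. *)
Lemma size_polar n g : (size g <= n.+1)%N -> (size (polar b n g) <= n)%N.
Proof.
elim: n g => [|n IHn] g sg.
  rewrite (size1_polyC sg) /polar fdiffC scaler0 mulr0 scale0r subrr.
  by rewrite size_poly0.
elim/poly_ind: g sg => [|p c _] sg.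
  by rewrite /polar raddf0 scaler0 mulr0 subrr scaler0 subrr size_poly0.
have sp : (size p <= n.+1)%N.
  have [->|p0] := eqVneq p 0; first by rewrite size_poly0.
  by move: sg; rewrite size_MXaddC (negbTE p0).
have -> : polar b n.+1 (p * 'X + c%:P) =
    ('X - b%:P) * (polar b n p - b *: fdiff b p) + (n.+1%:R * c)%:P.
  rewrite /polar [p * 'X]mulrC (raddfD (fdiff b)) /= fdiffC addr0 fdiff_mulX //.
  rewrite -!mul_polyC -natr1 polyCD polyCM polyC1; ring.
apply: leq_trans (size_polyD _ _) _.
rewrite geq_max (leq_trans (size_polyC_leq1 _)) // andbT.
apply: leq_trans (size_polyMleq _ _) _; rewrite size_XsubC /= ltnS.
apply: leq_trans (size_polyD _ _) _; rewrite geq_max IHn //= size_polyN.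
apply: leq_trans (size_scale_leq _ _) _.
apply: leq_trans (size_fdiff_pred _ _ b0) _.
by case: (size p) sp.
Qed.

Lemma fdiff_root_poly t m : m \in t ->
  (fdiff b (root_poly t)).[m] = (root_poly (rem m t)).[m - b].
Proof.
move=> mt; rewrite fdiffE (root_poly_rem _ _ mt) !hornerM !hornerXsubC.
by field.
Qed.

(** At a root of g only the two terms in D g survive, which makes the Lagrange
    coefficients of the polar polynomial proportional to those of D g. *)
Lemma polar_root_poly n t m : m \in t ->
  (polar b n.+1 (root_poly t)).[m] =
  - (m + n%:R * b) * (fdiff b (root_poly t)).[m].
Proof.
move=> mt; rewrite /polar; move: (fdiff b _) => d.
rewrite !hornerE (root_poly_rem _ _ mt) hornerM hornerXsubC -natr1; ring.
Qed.

(** The Lagrange coefficient of D g on g / (X - m): by [fdiff_root_poly] its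
    numerator is the value of D g at m. *)
Definition mesh_weight t m : R :=
  (root_poly (rem m t)).[m - b] / (root_poly (rem m t)).[m].

(** The weight is the product over the other roots v of 1 - b / (m - v), and
    every factor is positive because the gaps exceed b. *)
Lemma mesh_weight_ge0 t m : mesh t -> m \in t -> 0 <= mesh_weight t m.
Proof.
move=> tt mt; rewrite /mesh_weight !horner_root_poly -prodf_div big_seq.
apply: prodr_ge0 => v; rewrite mem_rem_uniq ?mesh_uniq // !inE => /andP[vm vt].
have := mesh_gap _ tt m v mt vt; rewrite eq_sym => /(_ vm).
have b_pos := b_gt0; case: (ltrgtP v m) vm => // _ _ bmv.
  by apply: divr_ge0; lra.
by rewrite -mulrNN -invrN; apply: divr_ge0; lra.
Qed.

Lemma fdiff_expansion t : mesh t ->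
  fdiff b (root_poly t) =
  \sum_(m <- t) mesh_weight t m *: root_poly (rem m t).
Proof.
move=> tt; rewrite {1}[fdiff b _](lagrange_interpolation t) ?mesh_uniq //.
  by apply: eq_big_seq => m mt; rewrite fdiff_root_poly.
by apply: leq_trans (size_fdiff_pred _ _ b0) _; rewrite size_root_poly.
Qed.

Lemma polar_expansion n t : mesh t -> size t = n.+1 ->
  polar b n.+1 (root_poly t) =
  - \sum_(m <- t)
      (mesh_weight t m * (m + n%:R * b)) *: root_poly (rem m t).
Proof.
move=> tt st; rewrite {1}[polar b _ _](lagrange_interpolation t) ?mesh_uniq //.
  rewrite -sumrN; apply: eq_big_seq => m mt.
  rewrite polar_root_poly // fdiff_root_poly // -scaleNr /mesh_weight.
  by congr (_ *: _); ring.
by rewrite st size_polar // size_root_poly st.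
Qed.

(** * Interlacing is preserved *)

Lemma interlaceE (u w : {poly R}) :
  u <<| w <-> forall x, (wronskian u w).[x] <= 0.
Proof. by []. Qed.

(** Changing c alters the second entry by a multiple of the first, so the root
    restored to p does not influence the Wronskian. *)
Lemma wronskian_conv_factor n p g c :
  wronskian (additive_conv b n p g) (additive_conv b n (('X - c%:P) * p) g) =
  wronskian (additive_conv b n p g) (additive_conv b n ('X * p) g).
Proof.
have -> : ('X - c%:P) * p = (- c) *: p + 'X * p.
  by rewrite -mul_polyC polyCN; ring.
have -> : additive_conv b n ((- c) *: p + 'X * p) g =
    (- c) *: additive_conv b n p g + additive_conv b n ('X * p) g.
  exact: (linearP (conv_op b n g)).
by rewrite wronskianDr wronskianZr wronskianxx scaler0 add0r.
Qed.

(** The inductive core.  The induction hypothesis is used with the roles of s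
    and t exchanged: two roots are removed from t, and one of them restored. *)
Lemma conv_interlace_mulX n s t : mesh s -> mesh t ->
    size s = n -> size t = n.+1 ->
  additive_conv b n.+1 (root_poly s) (root_poly t) <<|
  additive_conv b n.+1 ('X * root_poly s) (root_poly t).
Proof.
elim/ltn_ind: n s t => n IHn s t ss tt ssz tsz; apply/interlaceE => x.
have sp : (size (root_poly s) <= n.+1)%N by rewrite size_root_poly ssz.
pose A m := additive_conv b n (root_poly s) (root_poly (rem m t)).
pose L := additive_conv b n (root_poly s).
rewrite additive_conv_mulX // additive_conv_lower // fdiff_expansion //.
rewrite (polar_expansion _ _ tt tsz) (raddfN L) !(raddf_sum L) /=.
have AZ (c : R) m : additive_conv b n (root_poly s)
    (c *: root_poly (rem m t)) = c *: A m by exact: linearZ.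
under eq_bigr do rewrite AZ.
under [X in _ + - X]eq_bigr do rewrite AZ.
set P := \sum_(m <- t) _; set Q := \sum_(m <- t) _.
(* Q has the coefficients a_m c_m with c_m = m + n b, and the differences of
   the c_m are those of the roots. *)
suff PQ : 0 <= (wronskian P Q).[x].
  have -> : wronskian P ('X * P - Q) = - P ^+ 2 - wronskian P Q.
    by rewrite /wronskian derivB derivM derivX; ring.
  rewrite hornerD !hornerN horner_exp; have := sqr_ge0 P.[x]; lra.
apply: wronskian_weighted_chain => [m mt|m v mt vt].
  exact: mesh_weight_ge0.
have [->|vm] := eqVneq m v; first by rewrite subrr mul0r.
have ut := mesh_uniq _ tt.
have mv_t : m \in rem v t by rewrite mem_rem_uniq // inE vm.
case: n => [|n] in IHn ssz tsz sp A AZ L P Q *.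
  by have := size_rem vt; rewrite tsz; case: (rem v t) mv_t.
pose q := rem m (rem v t).
have AE w : w \in t -> A w =
    additive_conv b n.+1 (root_poly (rem w t)) (root_poly s).
  move=> wt; apply: additive_convC => //.
  by rewrite size_root_poly size_rem // tsz.
pose B := additive_conv b n.+1 (root_poly q) (root_poly s).
have AvE : A v = additive_conv b n.+1 (('X - m%:P) * root_poly q) (root_poly s).
  by rewrite AE // (root_poly_rem _ _ mv_t).
have AmE : A m = additive_conv b n.+1 (('X - v%:P) * root_poly q) (root_poly s).
  by rewrite AE // (root_poly_rem2 t m v).
(* The products g_v and g_m differ by (v - m) times their common factor q. *)
have AvmE : A v = A m + (v - m) *: B.
  rewrite AvE AmE [RHS]addrC.
  have -> : ('X - m%:P) * root_poly q =
      (v - m) *: root_poly q + ('X - v%:P) * root_poly q.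
    by rewrite -mul_polyC polyCB; ring.
  exact: (linearP (conv_op b n.+1 (root_poly s))).
have BA : (wronskian B (A m)).[x] <= 0.
  rewrite AmE wronskian_conv_factor; apply: IHn => //.
  - by do 2!apply: mesh_rem.
  - by rewrite /q !size_rem // tsz.
rewrite AvmE wronskianDr wronskianxx add0r wronskianZr wronskianC hornerZ hornerN.
have := mulr_ge0_le0 (sqr_ge0 (v - m)) BA.
rewrite -oppr_ge0; congr (_ <= _); ring.
Qed.

Lemma conv_interlace_rem n s t m : mesh s -> mesh t ->
    size s = n -> size t = n -> m \in s ->
  conv_op b n (root_poly t) (root_poly (rem m s)) <<|
  conv_op b n (root_poly t) (root_poly s).
Proof.
case: n => [|n] ss tt; first by case: s {ss}.
move=> ssz tsz mt; apply/interlaceE => x.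
rewrite [in X in wronskian _ X](root_poly_rem _ _ mt) /conv_op.
rewrite wronskian_conv_factor; apply: conv_interlace_mulX => //.
  exact: mesh_rem.
by rewrite size_rem // ssz.
Qed.

(** At a root m of w = c (X - m) q the Wronskian of r and w reduces to
    - r(m) w'(m) with w'(m) = c q(m). *)
Lemma interlace_nodes s (c : R) (r : {poly R}) m : mesh s -> m \in s ->
  r <<| c *: root_poly s ->
  0 <= c * (r.[m] / (root_poly (rem m s)).[m]).
Proof.
move=> ss ms /(_ m); rewrite (root_poly_rem _ _ ms).
set p := root_poly (rem m s).
have p0 : p.[m] != 0 by apply: root_poly_rem_neq0; apply: mesh_uniq.
have -> : (r^`() * (c *: (('X - m%:P) * p)) -
    r * (c *: (('X - m%:P) * p))^`()).[m] = - (r.[m] * (c * p.[m])).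
  rewrite derivZ derivM derivXsubC.
  by rewrite !(hornerD, hornerN, hornerM, hornerZ, hornerX, hornerC); ring.
rewrite oppr_le0 => rp.
have -> : c * (r.[m] / p.[m]) = r.[m] * (c * p.[m]) * p.[m] ^- 2 by field.
by rewrite mulr_ge0 // invr_ge0 sqr_ge0.
Qed.

(** Expand r over the roots of s: the component along root_poly s drops out of
    the Wronskian, the others are handled by [conv_interlace_rem].  The factor
    d enters squared, so both signs are covered. *)
Lemma conv_interlace n s t (c d : R) (r : {poly R}) : mesh s -> mesh t ->
    size s = n -> size t = n -> (size r <= n.+1)%N ->
    r <<| c *: root_poly s ->
  conv_op b n (d *: root_poly t) r <<|
  conv_op b n (d *: root_poly t) (c *: root_poly s).
Proof.
move=> ss tt ssz tsz sr rs; apply/interlaceE => x.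
have TZ p : conv_op b n (d *: root_poly t) p = d *: conv_op b n (root_poly t) p.
  exact: linearZ.
set T := conv_op b n (root_poly t).
have Tlin a p q : T (a *: p + q) = a *: T p + T q.
  exact: (linearP (conv_op b n (root_poly t))).
have Tscale a p : T (a *: p) = a *: T p.
  exact: linearZ.
rewrite !TZ -/T Tscale !(wronskianZl, wronskianZr) !hornerZ.
have us := mesh_uniq _ ss.
have coef_s : (root_poly s)`_n = 1.
  have /monicP := monic_prod_XsubC s xpredT id.
  by rewrite lead_coefE -/(root_poly s) size_root_poly ssz.
(* Lagrange interpolation at s needs degree below n: remove the top term. *)
pose r0 := r - r`_n *: root_poly s.
have sr0 : (size r0 <= size s)%N.
  rewrite ssz; apply/leq_sizeP => j; rewrite coefB coefZ leq_eqVlt.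
  case/predU1P => [<-|nj]; first by rewrite coef_s mulr1 subrr.
  have sj : (size (root_poly s) <= j)%N by rewrite size_root_poly ssz.
  by rewrite (nth_default _ (leq_trans sr nj)) (nth_default _ sj) mulr0 subrr.
have rE : r = r`_n *: root_poly s + \sum_(m <- s)
    (r.[m] / (root_poly (rem m s)).[m]) *: root_poly (rem m s).
  rewrite -[LHS](subrK (r`_n *: root_poly s)) addrC; congr (_ + _).
  rewrite -/r0 [LHS](lagrange_interpolation s r0 us sr0).
  apply: eq_big_seq => m ms; congr (_ / _ *: _).
  rewrite /r0 hornerD hornerN hornerZ [in X in _ - X](root_poly_rem _ _ ms).
  by rewrite hornerM hornerXsubC subrr mul0r mulr0 subr0.
have -> : wronskian (T r) (T (root_poly s)) = \sum_(m <- s)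
    (r.[m] / (root_poly (rem m s)).[m]) *:
      wronskian (T (root_poly (rem m s))) (T (root_poly s)).
  rewrite [in LHS]rE Tlin /T (raddf_sum (conv_op b n (root_poly t))) /= -/T.
  rewrite wronskianC wronskianDr wronskianZr wronskianxx scaler0 add0r.
  rewrite -wronskianC wronskian_suml; apply: eq_bigr => m _.
  by rewrite -/T Tscale wronskianZl.
rewrite mulrCA mulrA -expr2 horner_sum.
apply: mulr_ge0_le0; first exact: sqr_ge0.
rewrite mulr_sumr big_seq; apply: sumr_le0 => m ms.
rewrite hornerZ mulrA mulr_ge0_le0 ?interlace_nodes //.
exact: conv_interlace_rem.
Qed.

End Mesh.

Theorem theorem1p8 (R : realType) (b : R) (n : nat) (f g : {poly R})
    (hb : 0 < b)
    (hfn : size f = n.+1) (hgn : size g = n.+1)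
    (hf : strictly_mesh b f) (hg : strictly_mesh b g) :
  forall r : {poly R}, (size r <= n.+1)%N ->
    (r <<| f -> conv_op b n g r <<| conv_op b n g f) /\
    (f <<| r -> conv_op b n g f <<| conv_op b n g r).
Proof.
have [f0 [s fE ss]] := hf; have [g0 [t gE tt]] := hg.
have size_roots (h : {poly R}) (l : seq R) : h != 0 ->
    h = lead_coef h *: root_poly l -> size h = n.+1 -> size l = n.
  move=> h0 hE; rewrite hE size_scale ?lead_coef_eq0 // size_root_poly.
  by case.
have ssz := size_roots f s f0 fE hfn; have tsz := size_roots g t g0 gE hgn.
have left_interlace (r : {poly R}) : (size r <= n.+1)%N ->
    r <<| f -> conv_op b n g r <<| conv_op b n g f.
  by rewrite fE gE; apply: conv_interlace.
move=> r sr; split=> [|fr]; first exact: left_interlace.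
(* f << r is equivalent to - r << f, and the convolution is linear. *)
apply/interlaceE => x; rewrite wronskianC -wronskianNl -(raddfN (conv_op b n g)).
apply: left_interlace; first by rewrite size_polyN.
by apply/interlaceE => y; rewrite wronskianNl -wronskianC.
Qed.
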